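(* Let $m>1$ be real and let $(M^n,g,w)$ be a $(\lambda,n+m)$-Einstein manifold. Let $E_1,\dots,E_n$ be an orthonormal basis of a tangent space of $M$. Then for all tangent vectors $X,Y$ at that point $$\sum_{i=1}^nQ(X,E_i,E_i,Y)=\frac{m+n-2}{m}P(X,Y),$$ $$\sum_{i,j=1}^nQ(E_j,E_i,E_i,E_j)=\frac{m+n-2}{m(m-1)}\bigl((m+n-1)\,\mathrm{scal}-n(n-1)\lambda\bigr).$$
   Context: A $(\lambda,n+m)$-Einstein manifold $(M^n,g,w)$ (for $m>1$) is a connected complete Riemannian $n$-manifold $(M,g)$, possibly with boundary, together with a smooth function $w$ on $M$ such that $\mathrm{Hess}\,w=\frac{w}{m}(\mathrm{Ric}-\lambda g)$ on $M$, $w>0$ on $\mathrm{int}(M)$, and $w=0$ on $\partial M$. Define the function $\rho=\frac{1}{m-1}\bigl((n-1)\lambda-\mathrm{scal}\bigr)$, the symmetric $(0,2)$-tensor $P=\mathrm{Ric}-\rho g$, and the $(0,4)$-tensor $$Q=R+\frac2m\mathrm{Ric}\odot g-\frac{\lambda+\rho}{m}g\odot g.$$ For symmetric $(0,2)$-tensors $s,r$, $$(s\odot r)(X,Y,Z,W)=\tfrac12\bigl(r(X,W)s(Y,Z)+r(Y,Z)s(X,W)-r(X,Z)s(Y,W)-r(Y,W)s(X,Z)\bigr).$$ The curvature tensor convention is $R(X,Y,Z,W)=g(\nabla_X\nabla_YZ-\nabla_Y\nabla_XZ-\nabla_{[X,Y]}Z,W)$, so $\mathrm{Ric}(X,Y)=\sum_iR(X,E_i,E_i,Y)$.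 *)

(* Defs.v *)
From HB Require Import structures.
From mathcomp Require Import all_boot all_order all_algebra.
From mathcomp Require Import all_classical all_reals all_analysis.
Import Order.TTheory GRing.Theory Num.Theory.
Import numFieldNormedType.Exports.

Set Implicit Arguments.
Unset Strict Implicit.
Unset Printing Implicit Defensive.

Local Open Scope classical_set_scope.
Local Open Scope ring_scope.

(* Riemannian manifolds with boundary are set up here in local coordinates: a
   tangent vector at p is given by its components in a chart around p, and a
   tensor by its action on such components. *)

Section Smoothness.
Context {R : realType} {V : normedModType R}.

Fixpoint Ck_open (k : nat) (U : set V) (f : V -> R) : Prop :=
  (forall x, U x -> {for x, continuous f}) /\
  (if k is k'.+1 then
     forall v : V, (forall x, U x -> derivable f x v) /\
                   Ck_open k' U (fun x => 'D_v f x)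
   else True).

(* On an arbitrary set (e.g. a relatively open subset of the half-space),
   smooth means locally the restriction of a smooth function on an open set. *)
Definition smooth_on (D : set V) (f : V -> R) : Prop :=
  forall x, D x -> exists (U : set V) (F : V -> R),
    [/\ open U, U x, (forall k, Ck_open k U F) &
        forall y, U y -> D y -> F y = f y].

End Smoothness.

Section Coordinates.
Context {R : realType} {n : nat}.
Implicit Types (x u v X Y Z W : 'rV[R]_n) (G : 'rV[R]_n -> 'M[R]_n).

(* {x_0 >= 0}; all of R^n when n = 0. *)
Definition halfspace : set 'rV[R]_n :=
  [set x | forall i : 'I_n, i = 0%N :> nat -> 0 <= x 0 i].

Definition basis_vec (i : 'I_n) : 'rV[R]_n := delta_mx 0 i.

(* i-th partial derivative: the increment is restricted to keep the argument in the half-space, so that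
   the derivative is one-sided in the normal direction at boundary points. *)
Definition pderiv (i : 'I_n) (f : 'rV[R]_n -> R) (x : 'rV[R]_n) : R :=
  lim ((fun h : R => h^-1 * (f (x + h *: basis_vec i) - f x)) @
       within [set h : R | halfspace (x + h *: basis_vec i)] 0^').

Definition jacobian (F : 'rV[R]_n -> 'rV[R]_n) (x : 'rV[R]_n) : 'M[R]_n :=
  \matrix_(a, b) pderiv b (fun y => F y 0 a) x.

(* In the sequel G y is the matrix (g_ij) of the metric at the point with
   coordinates y. *)

Definition metric_form G x X Y : R := (X *m G x *m Y^T) 0 0.

Definition christoffel G (k i j : 'I_n) x : R :=
  2^-1 * \sum_l invmx (G x) k l *
    (pderiv i (fun y => G y j l) x + pderiv j (fun y => G y i l) x
     - pderiv l (fun y => G y i j) x).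

Definition nabla G (X Y : 'rV[R]_n -> 'rV[R]_n) : 'rV[R]_n -> 'rV[R]_n :=
  fun x => \row_k (\sum_i X x 0 i * pderiv i (fun y => Y y 0 k) x
    + \sum_i \sum_j christoffel G k i j x * X x 0 i * Y x 0 j).

Definition lie_bracket (X Y : 'rV[R]_n -> 'rV[R]_n) : 'rV[R]_n -> 'rV[R]_n :=
  fun x => \row_k \sum_i (X x 0 i * pderiv i (fun y => Y y 0 k) x
                          - Y x 0 i * pderiv i (fun y => X y 0 k) x).

Definition curvature_op G (X Y Z : 'rV[R]_n -> 'rV[R]_n) (x : 'rV[R]_n) :
    'rV[R]_n :=
  nabla G X (nabla G Y Z) x - nabla G Y (nabla G X Z) x
  - nabla G (lie_bracket X Y) Z x.

(* R is tensorial, so its value on tangent vectors is the multilinear extension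
   of its values on the coordinate fields. *)
Definition Riem_coef G x (i j k l : 'I_n) : R :=
  metric_form G x
    (curvature_op G (cst (basis_vec i)) (cst (basis_vec j))
                    (cst (basis_vec k)) x)
    (basis_vec l).

Definition Riem G x X Y Z W : R :=
  \sum_i \sum_j \sum_k \sum_l
    X 0 i * Y 0 j * Z 0 k * W 0 l * Riem_coef G x i j k l.

(* The metric trace of R over its second and third slots, i.e. the sum of
   R(X, E_i, E_i, Y) over an orthonormal basis. *)
Definition Ric G x X Y : R :=
  \sum_j \sum_k invmx (G x) j k * Riem G x X (basis_vec j) (basis_vec k) Y.

Definition scal G x : R :=
  \sum_i \sum_j invmx (G x) i j * Ric G x (basis_vec i) (basis_vec j).

Definition Hess G (f : 'rV[R]_n -> R) x X Y : R :=
  \sum_i \sum_j X 0 i * Y 0 j *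
    (pderiv i (pderiv j f) x - \sum_k christoffel G k i j x * pderiv k f x).

Definition odot (s r : 'rV[R]_n -> 'rV[R]_n -> R) X Y Z W : R :=
  2^-1 * (r X W * s Y Z + r Y Z * s X W - r X Z * s Y W - r Y W * s X Z).

Definition rho (lam m : R) G x : R :=
  (m - 1)^-1 * ((n%:R - 1) * lam - scal G x).

Definition P_tensor (lam m : R) G x X Y : R :=
  Ric G x X Y - rho lam m G x * metric_form G x X Y.

Definition Q_tensor (lam m : R) G x X Y Z W : R :=
  Riem G x X Y Z W
  + 2 / m * odot (Ric G x) (metric_form G x) X Y Z W
  - (lam + rho lam m G x) / m *
      odot (metric_form G x) (metric_form G x) X Y Z W.

End Coordinates.

(* A homeomorphism from an open subset of M onto a relatively open subset of
   the half-space; the values of the maps outside these sets are irrelevant. *)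
Record chart (R : realType) (n : nat) (M : topologicalType) := Chart {
  chart_dom : set M;
  chart_img : set 'rV[R]_n;
  chart_map :> M -> 'rV[R]_n;
  chart_inv : 'rV[R]_n -> M;
  chart_dom_open : open chart_dom;
  chart_img_open : exists2 V : set 'rV[R]_n,
    open V & chart_img = V `&` halfspace;
  chart_map_img : forall p, chart_dom p -> chart_img (chart_map p);
  chart_inv_dom : forall x, chart_img x -> chart_dom (chart_inv x);
  chart_mapK : forall p, chart_dom p -> chart_inv (chart_map p) = p;
  chart_invK : forall x, chart_img x -> chart_map (chart_inv x) = x;
  chart_map_cont : {within chart_dom, continuous chart_map};
  chart_inv_cont : {within chart_img, continuous chart_inv} }.

(* The atlas need not be maximal. *)
Record smooth_manifold (R : realType) (n : nat) := SmoothManifold {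
  carrier :> topologicalType;
  atlas : set (chart R n carrier);
  carrier_hausdorff : hausdorff_space carrier;
  carrier_second_countable : @second_countable carrier;
  atlas_cover : forall p : carrier,
    exists2 phi, atlas phi & chart_dom phi p;
  atlas_smooth : forall phi psi, atlas phi -> atlas psi ->
    forall a : 'I_n,
      smooth_on (phi @` (chart_dom phi `&` chart_dom psi))
                (fun x => psi (chart_inv phi x) 0 a) }.

Section Manifold.
Context {R : realType} {n : nat} (M : smooth_manifold R n).

Definition manifold_interior : set M :=
  [set p | exists phi : chart R n M,
     [/\ atlas phi, chart_dom phi p & interior halfspace (phi p)]].

Definition manifold_boundary : set M :=
  [set p | exists phi : chart R n M,
     [/\ atlas phi, chart_dom phi p & ~ interior halfspace (phi p)]].

Definition smooth_function (f : M -> R) : Prop :=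
  forall phi : chart R n M, atlas phi ->
    smooth_on (chart_img phi) (f \o chart_inv phi).

(* metric_in phi x is the matrix of the metric, in the chart phi, at the point
   with coordinates x; only charts of the atlas are constrained. *)
Record riemannian_metric := RiemannianMetric {
  metric_in :> chart R n M -> 'rV[R]_n -> 'M[R]_n;
  metric_sym : forall phi x, atlas phi -> chart_img phi x ->
    (metric_in phi x)^T = metric_in phi x;
  metric_posdef : forall phi x v, atlas phi -> chart_img phi x ->
    v != 0 -> 0 < metric_form (metric_in phi) x v v;
  metric_smooth : forall phi i j, atlas phi ->
    smooth_on (chart_img phi) (fun x => metric_in phi x i j);
  metric_compat : forall (phi psi : chart R n M) (p : M),
    atlas phi -> atlas psi -> chart_dom phi p -> chart_dom psi p ->
    let J := jacobian (psi \o chart_inv phi) (phi p) in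
    metric_in phi (phi p) = J^T *m metric_in psi (psi p) *m J }.

Variable g : riemannian_metric.

Definition smooth_segment (gam : R -> M) : Prop :=
  {within `[0, 1], continuous gam} /\
  forall phi : chart R n M, atlas phi -> forall i : 'I_n,
    smooth_on [set t : R^o | 0 <= t <= 1 /\ chart_dom phi (gam t)]
              (fun t => phi (gam t) 0 i).

Definition is_speed (gam : R -> M) (s : R -> R) : Prop :=
  forall t, 0 < t < 1 -> forall phi : chart R n M,
    atlas phi -> chart_dom phi (gam t) ->
    let v := \row_i derive1 (fun u : R => phi (gam u) 0 i) t in
    s t = Num.sqrt (metric_form (g phi) (phi (gam t)) v v).

(* joined p q L: a piecewise smooth curve of length L goes from p to q. *)
Inductive joined (p : M) : M -> R -> Prop :=
| joined_refl : joined p p 0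
| joined_step q L (gam : R -> M) (s : R -> R) :
    joined p q L -> smooth_segment gam -> gam 0 = q -> is_speed gam s ->
    joined p (gam 1) (L + \int[lebesgue_measure]_(t in `]0, 1[) s t).

Definition dist_lt (p q : M) (e : R) : Prop := exists2 L, joined p q L & L < e.

Definition riemannian_complete : Prop :=
  forall u : nat -> M,
    (forall e, 0 < e -> exists N, forall i j,
       (N <= i)%N -> (N <= j)%N -> dist_lt (u i) (u j) e) ->
    exists p : M, u @ \oo --> p.

Definition einstein_manifold (lam m : R) (w : M -> R) : Prop :=
  [/\ connected [set: M], riemannian_complete, smooth_function w,
      (forall (phi : chart R n M) (p : M), atlas phi -> chart_dom phi p ->
         forall X Y : 'rV[R]_n,
           Hess (g phi) (w \o chart_inv phi) (phi p) X Y =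
           w p / m * (Ric (g phi) (phi p) X Y
                      - lam * metric_form (g phi) (phi p) X Y)) &
      (forall p, manifold_interior p -> 0 < w p) /\
      (forall p, manifold_boundary p -> w p = 0)].

End Manifold.

(* Main.v *)
(* The identities are pointwise linear algebra. If the rows of F are an
   orthonormal basis for the Gram matrix G, then F G F^T = 1, so
   G^-1 = F^T F and every metric trace is a sum over the basis. Tracing
   Q = R + (2/m) Ric (.) g - ((lam + rho)/m) g (.) g over its middle slots
   gives Ric + ((n-2) Ric + scal g)/m - (n-1)(lam + rho) g/m; substituting
   scal - (n-1) lam = - (m-1) rho turns this into (m+n-2)/m (Ric - rho g). *)
Require Import Defs.
From HB Require Import structures.
From mathcomp Require Import all_boot all_order all_algebra.
From mathcomp Require Import all_classical all_reals all_analysis.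
From mathcomp Require Import ring lra.
Import Order.TTheory GRing.Theory Num.Theory.
Import numFieldNormedType.Exports.
Local Open Scope ring_scope.

Section OrthonormalFrames.
Context {R : realType} {n : nat}.
Variables (G : 'rV[R]_n -> 'M[R]_n) (x : 'rV[R]_n).

(** Common form for the metric ([A] is [G x]) and for [Ric] ([A] is [Ric_mx]), so that one
    contraction lemma serves both [odot] terms of [Q_tensor]. *)
Definition bilin (A : 'M[R]_n) (X Y : 'rV[R]_n) : R := (X *m A *m Y^T) 0 0.

Lemma bilinE A X Y : bilin A X Y = \sum_i \sum_j X 0 i * Y 0 j * A i j.
Proof.
rewrite /bilin mxE exchange_big; apply: eq_bigr => j _.
rewrite !mxE mulr_suml; apply: eq_bigr => i _.
by rewrite mulrAC.
Qed.

Lemma bilin_basis A i j : bilin A (basis_vec i) (basis_vec j) = A i j.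
Proof. by rewrite /bilin /basis_vec trmx_delta -rowE -colE !mxE. Qed.

Lemma Riem_basis X Y j k :
  Riem G x X (basis_vec j) (basis_vec k) Y =
  \sum_i \sum_l X 0 i * Y 0 l * Riem_coef G x i j k l.
Proof.
apply: eq_bigr => i _; rewrite (bigD1 j) //= [X in _ + X]big1 => [|j' j'j].
  rewrite (bigD1 k) //= [X in _ + X + _]big1 => [|k' k'k].
    rewrite !addr0; apply: eq_bigr => l _.
    by rewrite /basis_vec !mxE !eqxx !mulr1.
  by apply: big1 => l _; rewrite /basis_vec !mxE (negPf k'k) mulr0 !mul0r.
apply: big1 => k' _; apply: big1 => l _.
by rewrite /basis_vec !mxE (negPf j'j) mulr0 !mul0r.
Qed.

(** Only the two traced slots are expanded: with [U] and [V] both equal to [E i], summing the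
    coefficients over [i] produces the entries of the inverse metric. *)
Lemma Riem_inner X U V Y :
  Riem G x X U V Y =
  \sum_j \sum_k U 0 j * V 0 k * Riem G x X (basis_vec j) (basis_vec k) Y.
Proof.
under [RHS]eq_bigr => j _ do under eq_bigr => k _ do
  rewrite Riem_basis mulr_sumr.
rewrite /Riem exchange_big /=; apply: eq_bigr => j _.
rewrite exchange_big /=; apply: eq_bigr => k _.
apply: eq_bigr => i _.
by rewrite mulr_sumr; apply: eq_bigr => l _; ring.
Qed.

Definition Ric_mx : 'M[R]_n :=
  \matrix_(i, l) \sum_j \sum_k invmx (G x) j k * Riem_coef G x i j k l.

Lemma Ric_bilin X Y : Ric G x X Y = bilin Ric_mx X Y.
Proof.
rewrite bilinE /Ric.
under eq_bigr => j _ do under eq_bigr => k _ do rewrite Riem_basis mulr_sumr.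
under eq_bigr => j _ do rewrite exchange_big.
rewrite exchange_big; apply: eq_bigr => i _ /=.
under eq_bigr => j _ do under eq_bigr => k _ do rewrite mulr_sumr.
under eq_bigr => j _ do rewrite exchange_big.
rewrite exchange_big; apply: eq_bigr => l _ /=.
rewrite mxE mulr_sumr; apply: eq_bigr => j _.
by rewrite mulr_sumr; apply: eq_bigr => k _; ring.
Qed.

Variable E : 'I_n -> 'rV[R]_n.
Hypothesis E_orthonormal :
  forall i j, metric_form G x (E i) (E j) = (i == j)%:R.

Let F : 'M[R]_n := \matrix_i E i.

Let FGF : F *m G x *m F^T = 1%:M.
Proof.
apply/matrixP => i j; rewrite !mxE -E_orthonormal /metric_form mxE.
apply: eq_bigr => k _; rewrite !mxE; congr (_ * _).
by apply: eq_bigr => l _; rewrite !mxE.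
Qed.

Let FFG : F^T *m F *m G x = 1%:M.
(* For square matrices a one-sided inverse is two-sided, so the factors [F *m G x] and [F^T] of
   [FGF] may be swapped. *)
Proof. by rewrite -mulmxA; apply: mulmx1C. Qed.

Lemma orthonormal_invmx : invmx (G x) = F^T *m F.
Proof.
have [_ Gu] := mulmx1_unit FFG.
by rewrite -[RHS]mulmx1 -(mulmxV Gu) mulmxA FFG mul1mx.
Qed.

Lemma orthonormal_invmxE j k : invmx (G x) j k = \sum_i E i 0 j * E i 0 k.
Proof.
by rewrite orthonormal_invmx mxE; apply: eq_bigr => i _; rewrite !mxE.
Qed.

(** The existence of the frame forces this: the inverse of [G x] is [F^T *m F], which is
    symmetric. *)
Lemma metric_sym_orthonormal X Y : metric_form G x X Y = metric_form G x Y X.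
Proof.
have [_ Gu] := mulmx1_unit FFG.
have GT : (G x)^T = G x.
  by rewrite -[G x]invmxK trmx_inv orthonormal_invmx trmx_mul trmxK.
rewrite /metric_form; have <- : (Y *m G x *m X^T)^T = X *m G x *m Y^T.
  by rewrite !trmx_mul trmxK GT mulmxA.
by rewrite mxE.
Qed.

Lemma sum_metric : \sum_i metric_form G x (E i) (E i) = n%:R.
Proof.
under eq_bigr => i _ do rewrite E_orthonormal eqxx.
by rewrite sumr_const card_ord.
Qed.

(** [X] equals [X *m G x *m F^T *m F], a combination of the rows of [F] whose coefficients are the
    entries of [X *m G x *m F^T]. *)
Lemma orthonormal_expansion X : \sum_i metric_form G x X (E i) *: E i = X.
Proof.
have GFF : G x *m (F^T *m F) = 1%:M by apply: mulmx1C.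
rewrite -[RHS]mulmx1 -GFF !mulmxA [RHS]mulmx_sum_row.
apply: eq_bigr => i _; rewrite rowK /metric_form !mxE; congr (_ *: _).
by apply: eq_bigr => k _; rewrite !mxE.
Qed.

Lemma sum_metric_bilin A X Y :
  \sum_i metric_form G x X (E i) * bilin A (E i) Y = bilin A X Y.
Proof.
rewrite -{2}[X]orthonormal_expansion /bilin !mulmx_suml summxE.
by apply: eq_bigr => i _; rewrite -!scalemxAl [RHS]mxE.
Qed.

Lemma sum_bilin_metric A X Y :
  \sum_i metric_form G x (E i) Y * bilin A X (E i) = bilin A X Y.
Proof.
rewrite -{2}[Y]orthonormal_expansion /bilin linear_sum mulmx_sumr summxE.
apply: eq_bigr => i _.
by rewrite metric_sym_orthonormal linearZ -scalemxAr [RHS]mxE.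
Qed.

Lemma sum_Riem X Y : \sum_i Riem G x X (E i) (E i) Y = Ric G x X Y.
Proof.
under eq_bigr => i _ do rewrite Riem_inner.
rewrite exchange_big; apply: eq_bigr => j _ /=.
rewrite exchange_big; apply: eq_bigr => k _ /=.
by rewrite orthonormal_invmxE mulr_suml.
Qed.

Lemma sum_Ric : \sum_i Ric G x (E i) (E i) = scal G x.
Proof.
under eq_bigr => i _ do rewrite Ric_bilin bilinE.
rewrite exchange_big; apply: eq_bigr => j _ /=.
rewrite exchange_big; apply: eq_bigr => k _ /=.
by rewrite Ric_bilin bilin_basis orthonormal_invmxE mulr_suml.
Qed.

(** The two positive terms give the trace of [A] times the metric and [n] copies of [A]; each of the
    two mixed terms contracts to one copy of [A], whence [n - 2]. *)
Lemma sum_odot_metric A X Y :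
  \sum_i odot (bilin A) (metric_form G x) X (E i) (E i) Y =
  2^-1 * ((\sum_i bilin A (E i) (E i)) * metric_form G x X Y
          + (n%:R - 2) * bilin A X Y).
Proof.
rewrite /odot -mulr_sumr !sumrB big_split /= -mulr_sumr -mulr_suml sum_metric.
rewrite sum_metric_bilin sum_bilin_metric; ring.
Qed.

Lemma sum_Q lam m X Y : 1 < m ->
  \sum_i Q_tensor lam m G x X (E i) (E i) Y =
  (m + n%:R - 2) / m * P_tensor lam m G x X Y.
Proof.
move=> m_gt1; have m_neq0 : m != 0 by lra.
have m1_neq0 : m - 1 != 0 by lra.
(* [odot] takes [Ric G x] unapplied, so an equality of functions is required. *)
have RicE : Ric G x = bilin Ric_mx.
  by apply/funext => U; apply/funext => V; exact: Ric_bilin.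
have sum_Ric_odot := sum_odot_metric Ric_mx X Y.
have sum_metric_odot := sum_odot_metric (G x) X Y.
rewrite -RicE sum_Ric in sum_Ric_odot.
(* The metric has trace [n], so its [odot] square contracts to [(n + n - 2) / 2], that is [n - 1],
   times the metric. *)
rewrite -[bilin (G x)]/(metric_form G x) sum_metric in sum_metric_odot.
rewrite /Q_tensor sumrB big_split /= sum_Riem.
rewrite -[X in _ + X - _]mulr_sumr -[X in _ - X]mulr_sumr.
rewrite sum_Ric_odot sum_metric_odot /P_tensor /rho.
by field; apply/andP.
Qed.

Lemma sum_P lam m :
  \sum_i P_tensor lam m G x (E i) (E i) = scal G x - n%:R * rho lam m G x.
Proof. by rewrite /P_tensor sumrB sum_Ric -mulr_sumr sum_metric mulrC. Qed.

End OrthonormalFrames.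

Theorem proposition6p1 (R : realType) (n : nat) (m lam : R)
    (M : smooth_manifold R n) (g : riemannian_metric M) (w : M -> R)
    (m_gt1 : 1 < m) (einstein : einstein_manifold g lam m w)
    (p : M) (phi : chart R n M) (phi_atlas : atlas phi)
    (p_phi : chart_dom phi p) (E : 'I_n -> 'rV[R]_n)
    (E_orthonormal : forall i j,
       metric_form (g phi) (phi p) (E i) (E j) = (i == j)%:R) :
  (forall X Y : 'rV[R]_n,
     \sum_(i < n) Q_tensor lam m (g phi) (phi p) X (E i) (E i) Y =
     (m + n%:R - 2) / m * P_tensor lam m (g phi) (phi p) X Y) /\
  \sum_(i < n) \sum_(j < n)
     Q_tensor lam m (g phi) (phi p) (E j) (E i) (E i) (E j) =
  (m + n%:R - 2) / (m * (m - 1)) *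
    ((m + n%:R - 1) * scal (g phi) (phi p) - n%:R * (n%:R - 1) * lam).
Proof.
split=> [X Y|]; first exact: sum_Q.
(* With the sum over [i] innermost, the first identity applies at [X = Y = E j], which leaves the
   trace of [P_tensor]. *)
rewrite exchange_big /=; under eq_bigr => j _ do rewrite sum_Q //.
rewrite -mulr_sumr sum_P // /rho.
by field; apply/andP; split; lra.
Qed.
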